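(* Let $k>1$ be an integer and let $d=k^{2}+4$. If $k$ is odd, then the fundamental solution to the equation $x^{2}-dy^{2}=-1$ is $$x_{1}+y_{1}\sqrt{d}=\frac{k^{3}+3k}{2}+\frac{k^{2}+1}{2}\sqrt{d}.$$ If $k$ is even, the equation $x^{2}-dy^{2}=-1$ has no positive integer solutions.
   Context: For a positive integer $d$ that is not a perfect square and a nonzero integer $N$, a pair $(a,b)$ of integers with $a^{2}-db^{2}=N$ is identified with $a+b\sqrt{d}$ and called a solution of $x^{2}-dy^{2}=N$; it is positive if $a>0$ and $b>0$. The fundamental solution of $x^{2}-dy^{2}=N$ is the positive solution $x_{1}+y_{1}\sqrt{d}$ such that $x_{1}+y_{1}\sqrt{d}<x_{2}+y_{2}\sqrt{d}$ for every other positive solution $x_{2}+y_{2}\sqrt{d}$ of the same equation. *)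

(* Defs.v *)
From Stdlib Require Import ZArith Reals.

Open Scope Z_scope.

Definition solution (d N : Z) (p : Z * Z) : Prop :=
  fst p ^ 2 - d * snd p ^ 2 = N.

Definition positive_solution (d N : Z) (p : Z * Z) : Prop :=
  solution d N p /\ 0 < fst p /\ 0 < snd p.

(* The pair (a, b) seen as the real number a + b sqrt d. *)
Definition quad_value (d : Z) (p : Z * Z) : R :=
  (IZR (fst p) + IZR (snd p) * sqrt (IZR d))%R.

(* Meant for d positive and not a perfect square and N nonzero. *)
Definition fundamental_solution (d N : Z) (p : Z * Z) : Prop :=
  positive_solution d N p /\
  forall q : Z * Z, positive_solution d N q -> q <> p ->
    (quad_value d p < quad_value d q)%R.

(* Main.v *)
Require Import Defs.
From Stdlib Require Import ZArith Reals Lia.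

Open Scope Z_scope.

(** Let [d = k^2 + 4].  The unit [alpha = (k + sqrt d) / 2] has norm [-1], and
    for odd [k] the claimed fundamental solution is [alpha^3], the first odd
    power of [alpha] with integer coordinates.

    Minimality comes from dividing an arbitrary positive solution
    [a + b sqrt d] twice by [alpha].  The coefficients of [sqrt d / 2] met on
    the way, [2b], [t = a - k b] and [s = 2b - k t], stay positive, which forces
    [t >= k s >= k] and hence [2b = k t + s >= k^2 + 1]
    ([second_coordinate_lower_bound]).  So the candidate has the least possible
    second coordinate.  On positive solutions the second coordinate determines
    the first, increasingly ([first_coordinate_increasing]), so every other
    positive solution is strictly larger in both coordinates.

    For even [k], the integer [d] is divisible by 4, and [-1] is not a square
    modulo 4. *)

(** Dividing by [alpha] twice: [t] is positive because [t (a + k b) = 4 b^2 - 1],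
    then [s] because [2 b s = t^2 + 1], and the norm of the resulting element
    gives [t (t - k s) = s^2 - 1], which is nonnegative. *)
Lemma second_coordinate_lower_bound (k a b : Z) :
  0 < k -> 0 < a -> 0 < b -> a ^ 2 - (k ^ 2 + 4) * b ^ 2 = -1 ->
  k ^ 2 + 1 <= 2 * b.
Proof.
  intros hk ha hb hab.
  pose (t := a - k * b); pose (s := 2 * b - k * t).
  assert (ht : t * (a + k * b) = 4 * b ^ 2 - 1) by (unfold t; nia).
  assert (hs : 2 * b * s = t ^ 2 + 1) by (unfold s, t; nia).
  assert (hts : t * (t - k * s) = s ^ 2 - 1) by (unfold s, t; nia).
  assert (eb : 2 * b = k * t + s) by (unfold s; lia).
  clearbody t s.
  assert (0 < t) by nia.
  assert (0 < s) by nia.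
  assert (k * s <= t) by nia.
  nia.
Qed.

Lemma first_coordinate_increasing (d N a b a' b' : Z) :
  0 < d -> solution d N (a, b) -> solution d N (a', b') ->
  0 < b -> 0 < a' -> b < b' -> a < a'.
Proof.
  unfold solution; simpl fst; simpl snd; intros hd h h' hb ha' hbb.
  assert (d * b ^ 2 < d * b' ^ 2) by (apply Z.mul_lt_mono_pos_l; nia).
  nia.
Qed.

Lemma first_coordinate_unique (d N a a' b : Z) :
  solution d N (a, b) -> solution d N (a', b) -> 0 < a -> 0 < a' -> a = a'.
Proof. unfold solution; simpl fst; simpl snd; nia. Qed.

Lemma quad_value_lt (d a b a' b' : Z) :
  a < a' -> b < b' -> (quad_value d (a, b) < quad_value d (a', b'))%R.
Proof.
  intros ha hb; unfold quad_value; simpl.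
  apply Rplus_lt_le_compat; [now apply IZR_lt|].
  apply Rmult_le_compat_r; [apply sqrt_pos | apply IZR_le; lia].
Qed.

Lemma no_solution_of_4_divides (d : Z) (p : Z * Z) :
  (4 | d) -> ~ solution d (-1) p.
Proof.
  intros [e ->]; destruct p as [a b]; unfold solution; simpl fst; simpl snd.
  intros h; destruct (Z.Even_or_Odd a) as [[c ->]|[c ->]]; nia.
Qed.

(* For odd k both divisions by 2 are exact. *)
Theorem corollary1 (k d : Z) (hk : 1 < k) (hd : d = k ^ 2 + 4) :
  (Z.Odd k ->
     fundamental_solution d (-1) ((k ^ 3 + 3 * k) / 2, (k ^ 2 + 1) / 2)) /\
  (Z.Even k -> ~ exists p : Z * Z, positive_solution d (-1) p).
Proof.
  split.
  - intros [m hm].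
    assert (ey : 2 * ((k ^ 2 + 1) / 2) = k ^ 2 + 1).
    { symmetry; apply Z_div_exact_full_2; [lia|].
      replace (k ^ 2 + 1) with ((2 * m ^ 2 + 2 * m + 1) * 2) by (subst k; ring).
      apply Z_mod_mult. }
    assert (ex : 2 * ((k ^ 3 + 3 * k) / 2) = k ^ 3 + 3 * k).
    { symmetry; apply Z_div_exact_full_2; [lia|].
      replace (k ^ 3 + 3 * k) with ((k * (2 * m ^ 2 + 2 * m + 2)) * 2)
        by (subst k; ring).
      apply Z_mod_mult. }
    set (x := (k ^ 3 + 3 * k) / 2) in *; set (y := (k ^ 2 + 1) / 2) in *.
    clearbody x y.
    assert (hx : 0 < x) by nia.
    assert (hy : 0 < y) by nia.
    assert (hxy : solution d (-1) (x, y)).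
    { unfold solution; simpl fst; simpl snd.
      assert ((2 * x) ^ 2 - d * (2 * y) ^ 2 = -4)
        by (rewrite ex, ey, hd; ring).
      lia. }
    split; [now repeat split|].
    intros [a b] (hab & ha & hb) hne; simpl in ha, hb.
    assert (hyb : y <= b).
    { pose proof (second_coordinate_lower_bound k a b) as hlow.
      unfold solution in hab; simpl fst in hab; simpl snd in hab.
      rewrite hd in hab; specialize (hlow ltac:(lia) ha hb hab); lia. }
    assert (hyb' : y < b).
    { destruct (Z.eq_dec y b) as [->|]; [|lia].
      case hne; f_equal; eapply first_coordinate_unique; eauto. }
    apply quad_value_lt; [|assumption].
    apply (first_coordinate_increasing d (-1) x y a b); auto; nia.
  - intros [m hm] [p [hp _]].
    apply (no_solution_of_4_divides d p); [|assumption].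
    exists (m ^ 2 + 1); subst; ring.
Qed.
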